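(* Let $(\mathfrak g,H,\mathcal G_g)$ be a generalised pseudo-Riemannian Lie algebra and $\delta\in E^*=(\mathfrak g\oplus\mathfrak g^* )^*$. Then $(\mathfrak g,H,\mathcal G_g,\delta)$ is generalised Einstein if and only if for all $X,Y\in\mathfrak g$: \begin{align*} -4\,\delta(\mathrm{ad}_X^*(X))&=4\,g(\mathrm{ad}_X^S,\mathrm{ad}_X^S)-g(\mathrm{ad}^*(X),\mathrm{ad}^*(X))+2\,g(H(X,\cdot,\cdot),H(X,\cdot,\cdot)),\\ 2\,\delta\left(H(X,Y,\cdot)^{\sharp}+[X,Y]^\flat\right)&=g(H_X,\mathrm{ad}^*(Y))-g(H_Y,\mathrm{ad}^*(X)),\\ \delta\left((\mathrm{ad}_X^*(X))^\flat\right)&=0,\\ \delta\left([X,Y]+H(X,Y,\cdot)\right)&=0. \end{align*}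
   Context: Let $\mathfrak g$ be a finite-dimensional real Lie algebra. A generalised pseudo-Riemannian metric on $\mathfrak g$ is a pair $(H,\mathcal G_g)$ where $H\in\Lambda^3\mathfrak g^*$ is closed for the Chevalley–Eilenberg differential (normalised by $d\alpha(X,Y)=-\alpha([X,Y])$), $g$ is a non-degenerate symmetric bilinear form on $\mathfrak g$, and $\mathcal G_g$ is the endomorphism of $E=\mathfrak g\oplus\mathfrak g^*$ given by $\mathcal G_g(X+\xi)=\xi^\sharp+X^\flat$, with $X^\flat=g(X,\cdot)$ and $\sharp=\flat^{-1}$; then $(\mathfrak g,H,\mathcal G_g)$ is called a generalised pseudo-Riemannian Lie algebra. Let $E_\pm=\{X\pm X^\flat\mid X\in\mathfrak g\}$ be the $\pm1$-eigenspaces of $\mathcal G_g$ and $\pi_\pm=\frac12(\mathrm{id}\pm\mathcal G_g):E\to E_\pm$. The $H$-twisted Dorfman bracket on $E$ is $[X+\xi,Y+\eta]_H=[X,Y]+d\eta(X,\cdot)-d\xi(Y,\cdot)+H(X,Y,\cdot)$. A divergence operator is an element $\delta\in E^*$. For $u\in E_+$, $v\in E_-$ put $\Gamma_u=\pi_+\circ[u,\cdot]_H|_{E_-}:E_-\to E_+$ and $\Gamma_v=\pi_-\circ[v,\cdot]_H|_{E_+}:E_+\to E_-$. The generalised Ricci curvatures of $(\mathcal G_g,\delta)$ are, by a known result taken here as definition, $\mathcal{RC}^+(v,u)=-\mathrm{tr}(\Gamma_v\circ\Gamma_u)+\delta(\pi_+[v,u]_H)$ and $\mathcal{RC}^-(u,v)=-\mathrm{tr}(\Gamma_v\circ\Gamma_u)+\delta(\pi_-[u,v]_H)$.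 The quadruple $(\mathfrak g,H,\mathcal G_g,\delta)$ is generalised Einstein if $\mathcal{RC}^+=0$ and $\mathcal{RC}^-=0$ (for all $u\in E_+$, $v\in E_-$). Notation: $F^*$ is the $g$-adjoint of an endomorphism $F$ and $F^S=\frac12(F+F^* )$. $\mathrm{ad}^*(X)\in\mathrm{End}(\mathfrak g)$ is $Y\mapsto \mathrm{ad}_Y^*(X)$, and $H_X\in\mathrm{End}(\mathfrak g)$ is $Y\mapsto H(X,Y,\cdot)^\sharp$. For an orthonormal basis $(e_i)$ with $g(e_i,e_i)=\epsilon_i\in\{\pm1\}$, $g(F,G)=\sum_i\epsilon_i\,g(F(e_i),G(e_i))$ for endomorphisms, and on two-forms $g$ is the scalar product for which the $e^i\wedge e^j$ ($i<j$) are pairwise orthogonal with $g(e^i\wedge e^j,e^i\wedge e^j)=\epsilon_i\epsilon_j$. *)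

(* Defs.v *)
From HB Require Import structures.
From mathcomp Require Import all_boot all_order all_algebra.
From mathcomp Require Import boolp reals.
From mathcomp Require Import ring.

Set Implicit Arguments.
Unset Strict Implicit.
Unset Printing Implicit Defensive.

Import Order.TTheory GRing.Theory Num.Theory.
Local Open Scope ring_scope.

HB.mixin Record Vector_isLieAlgebra (R : fieldType) L of Vector R L := {
  lie : {bilinear L -> L -> L};
  liexx : forall X : L, lie X X = 0;
  lie_jacobi : forall X Y Z : L,
    lie X (lie Y Z) + lie Y (lie Z X) + lie Z (lie X Y) = 0
}.

#[short(type="lieAlgType")]
HB.structure Definition LieAlgebra (R : fieldType) :=
  {L of Vector_isLieAlgebra R L & Vector R L}.

Lemma linfun_linearE (K : fieldType) (U V : vectType K) (f : U -> V) :
  linear f -> linfun f =1 f.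
Proof.
move=> lin_f u.
pose f' : {linear U -> V} := HB.pack f (GRing.isLinear.Build K U V _ f lin_f).
by rewrite -[linfun f]/(linfun f') lfunE.
Qed.

Section LieForms.
Variables (R : realType) (L : lieAlgType R).

Definition dual := 'Hom(L, R^o).

Definition ce_diff1 (xi : L -> R) (X Y : L) : R := - xi (lie X Y).

(* Sum over i < j of (-1)^(i+j) H([X_i, X_j], remaining arguments in order),   *)
(* the extension of the normalisation chosen in ce_diff1.                      *)
Definition ce_diff3 (H : L -> L -> L -> R) (X0 X1 X2 X3 : L) : R :=
  - H (lie X0 X1) X2 X3 + H (lie X0 X2) X1 X3 - H (lie X0 X3) X1 X2
  - H (lie X1 X2) X0 X3 + H (lie X1 X3) X0 X2 - H (lie X2 X3) X0 X1.

Record closed3form := Closed3Form {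
  form3 :> L -> L -> L -> R;
  form3_linear1 : forall Y Z, scalar (fun X => form3 X Y Z);
  form3_linear2 : forall X Z, scalar (fun Y => form3 X Y Z);
  form3_linear3 : forall X Y, scalar (form3 X Y);
  form3_alt12 : forall X Z, form3 X X Z = 0;
  form3_alt13 : forall X Y, form3 X Y X = 0;
  form3_alt23 : forall X Y, form3 X Y Y = 0;
  form3_closed : forall X0 X1 X2 X3, ce_diff3 form3 X0 X1 X2 X3 = 0
}.

Record pseudoMetric := PseudoMetric {
  metric :> {symmetric L};
  metric_nondegenerate : nondegenerate metric
}.

End LieForms.

Section Metric.
Variables (R : realType) (L : lieAlgType R) (g : pseudoMetric L).

Lemma metricC X Y : g X Y = g Y X.
Proof. by rewrite hermC expr0 mul1r. Qed.

Lemma metric_eq0 X : (forall Y, g X Y = 0) -> X = 0.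
Proof.
move=> gX0; apply/eqP; rewrite -memv0 -(eqP (metric_nondegenerate g)).
by apply/mem_orthovP => Y _; rewrite gX0.
Qed.

Definition flat : 'Hom(L, dual L) :=
  linfun (fun X : L => linfun (g X : L -> R^o)).

(* A one-sided inverse for general linear maps; two-sided here because g is    *)
(* non-degenerate, see flatK and sharpK.                                       *)
Definition sharp : 'Hom(dual L, L) := (flat^-1)%VF.

Lemma flatE X Y : flat X Y = g X Y.
Proof.
rewrite linfun_linearE ?lfunE // => a U V; apply/lfunP => Z.
by rewrite !lfunE /= !lfunE /= lfunE /= linearPl.
Qed.

Lemma flat_ker0 : lker flat == 0%VS.
Proof.
apply/lker0P => X Y eqXY; apply/eqP; rewrite -subr_eq0; apply/eqP.
have flat0 : flat (X - Y) = 0 by rewrite linearB /= eqXY subrr.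
by apply: metric_eq0 => Z; rewrite -flatE flat0 lfunE.
Qed.

Lemma flatK : cancel flat sharp.
Proof. exact: lker0_lfunK flat_ker0. Qed.

Lemma dimv_dual : \dim {: dual L} = \dim {: L}.
Proof. by rewrite !dimvf /dim /= muln1. Qed.

Lemma sharpK : cancel sharp flat.
Proof.
have flat_full : limg flat = fullv.
  apply/eqP; rewrite eqEdim subvf /= limg_dim_eq ?dimv_dual //.
  by rewrite (eqP flat_ker0) capv0.
by move=> xi; apply: limg_lfunVK; rewrite flat_full memvf.
Qed.

Lemma sharpE xi X : g (sharp xi) X = xi X.
Proof. by rewrite -flatE sharpK. Qed.

Definition adjoint (F : 'End(L)) : 'End(L) :=
  linfun (fun Y => sharp (linfun (fun X => g (F X) Y : R^o))).

Definition symmetrisation (F : 'End(L)) : 'End(L) := 2^-1 *: (F + adjoint F).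

Definition ad (X : L) : 'End(L) := linfun (lie X).

Definition adstar (X : L) : 'End(L) := linfun (fun Y => adjoint (ad Y) X).

Definition form_endo (H : closed3form L) (X : L) : 'End(L) :=
  linfun (fun Y => sharp (linfun (H X Y : L -> R^o))).

Lemma adjointE F X Y : g X (adjoint F Y) = g (F X) Y.
Proof.
have linY Z : linear (fun X' : L => g (F X') Z : R^o).
  by move=> a U V; rewrite linearP linearPl.
rewrite linfun_linearE => [|a U V]; first by rewrite metricC sharpE linfun_linearE.
rewrite -linearP; congr (sharp _); apply/lfunP => Z.
by rewrite !lfunE /= !lfunE /= !linfun_linearE // linearPr.
Qed.

Lemma adE X Y : ad X Y = lie X Y.
Proof. exact: lfunE. Qed.

Lemma adstarE X Y : adstar X Y = adjoint (ad Y) X.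
Proof.
rewrite linfun_linearE // => a U V; apply/eqP; rewrite -subr_eq0; apply/eqP.
apply: metric_eq0 => Z; rewrite metricC linearBr linearPr /= !adjointE !adE.
have -> : lie (a *: U + V) Z = a *: lie U Z + lie V Z by rewrite linearPl.
by rewrite linearPl subrr.
Qed.

Lemma form_endoE (H : closed3form L) X Y Z : g (form_endo H X Y) Z = H X Y Z.
Proof.
have lin U : linear (H X U : L -> R^o) by apply: form3_linear3.
rewrite linfun_linearE => [|a U V]; first by rewrite sharpE linfun_linearE.
rewrite -linearP; congr (sharp _); apply/lfunP => W.
by rewrite !lfunE /= !lfunE /= !linfun_linearE // form3_linear2.
Qed.

Definition is_orthonormal n (e : n.-tuple L) : Prop :=
  (forall i j : 'I_n, i != j -> g e`_i e`_j = 0) /\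
  (forall i : 'I_n, g e`_i e`_i = 1 \/ g e`_i e`_i = -1).

Lemma orthonormal_free n (e : n.-tuple L) : is_orthonormal e -> free e.
Proof.
move=> [eo e1]; apply/freeP => k sum0 i.
have : g (\sum_(j < n) k j *: e`_j) e`_i = 0 by rewrite sum0 linear0l.
rewrite linear_sumlz (bigD1 i) //= big1 => [|j ji].
  rewrite addr0 linearZl_LR /=.
  by case: (e1 i) => ->; rewrite ?mulrN1 ?mulr1 // => /eqP; rewrite oppr_eq0 => /eqP.
by rewrite linearZl_LR /= eo ?mulr0.
Qed.

Lemma orthonormal_extend n (e : n.-tuple L) : (n < \dim {: L})%N ->
  is_orthonormal e -> exists e' : n.+1.-tuple L, is_orthonormal e'.
Proof.
move=> ltn [eo e1].
pose eps i := g e`_i e`_i.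
have eps2 (i : 'I_n) : eps i * eps i = 1.
  by rewrite /eps; case: (e1 i) => ->; rewrite ?mulrNN mulr1.
pose pr X := X - \sum_(i < n) (eps i * g X e`_i) *: e`_i.
have pr_orth X (i : 'I_n) : g (pr X) e`_i = 0.
  rewrite /pr linearBl linear_sumlz (bigD1 i) //= big1 => [|j ji].
    by rewrite addr0 linearZl_LR /= mulrAC -/(eps i) eps2 mul1r subrr.
  by rewrite linearZl_LR /= eo ?mulr0.
have gpr W X : (forall i : 'I_n, g W e`_i = 0) -> g W (pr X) = g W X.
  move=> We; rewrite /pr linearBr linear_sumr big1 ?subr0 // => i _.
  by rewrite linearZr_LR /= We mulr0.
have [W Worth Wn0] : exists2 W, (forall i : 'I_n, g W e`_i = 0) & g W W != 0.
  have [X prX] : exists X, pr X != 0.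
    apply: contrapT => /forallNP pr0.
    suff : (\dim {: L} <= n)%N by rewrite leqNgt ltn.
    rewrite (leq_trans _ (_ : \dim <<e>> <= n)%N) //; last first.
      by rewrite (leq_trans (dim_span e)) ?size_tuple.
    apply/dimvS/subvP => X _.
    have /negP/negPn := pr0 X; rewrite subr_eq0 => /eqP ->.
    by apply: rpred_sum => i _; rewrite rpredZ ?memv_span ?mem_nth ?size_tuple.
  have [Y gXY] : exists Y, g (pr X) Y != 0.
    apply: contrapT => /forallNP gX0; move/eqP: prX; apply.
    by apply: metric_eq0 => Y; have /negP/negPn/eqP := gX0 Y.
  have {}gXY : g (pr X) (pr Y) != 0 by rewrite gpr.
  have [gX0|] := eqVneq (g (pr X) (pr X)) 0; last by exists (pr X).
  have [gY0|] := eqVneq (g (pr Y) (pr Y)) 0; last by exists (pr Y).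
  exists (pr X + pr Y) => [i|]; first by rewrite linearDl /= !pr_orth addr0.
  move: (pr X) (pr Y) gX0 gY0 gXY => A B gA gB gAB.
  rewrite linearDl /= !linearDr /= gA gB addr0 add0r (metricC B).
  by rewrite -mulr2n mulrn_eq0.
pose U := (Num.sqrt `|g W W|)^-1 *: W.
have Uorth (i : 'I_n) : g U e`_i = 0 by rewrite linearZl_LR /= Worth mulr0.
have Unorm : g U U = 1 \/ g U U = -1.
  rewrite linearZl_LR linearZr_LR /= mulrA -expr2 exprVn sqr_sqrtr //.
  have [gW|gW] := ltrP (g W W) 0; [right|left].
    by rewrite ltr0_norm // invrN mulNr mulVf.
  by rewrite ger0_norm // mulVf.
exists [tuple of U :: e]; split=> [i j|i].
  case: (unliftP ord0 i) => [i' ->|->]; case: (unliftP ord0 j) => [j' ->|->] //=.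
  - by rewrite (inj_eq lift_inj) => /eo.
  - by move=> _; rewrite metricC Uorth.
  - by move=> _; rewrite Uorth.
case: (unliftP ord0 i) => [i' ->|->] //=; exact: e1.
Qed.

Lemma exists_orthonormal_basis :
  exists e : (\dim {: L}).-tuple L, is_orthonormal e /\ basis_of {: L} e.
Proof.
have ex n : (n <= \dim {: L})%N -> exists e : n.-tuple L, is_orthonormal e.
  elim: n => [_|n IH ltn]; first by exists [tuple]; split=> -[].
  by have [e eP] := IH (ltnW ltn); apply: orthonormal_extend eP.
have [e eP] := ex _ (leqnn _); exists e; split=> //.
by rewrite basisEfree (orthonormal_free eP) subvf size_tuple leqnn.
Qed.

Definition onb : (\dim {: L}).-tuple L := sval (cid exists_orthonormal_basis).

Lemma onbP : is_orthonormal onb /\ basis_of {: L} onb.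
Proof. exact: svalP (cid exists_orthonormal_basis). Qed.

Definition onb_sign (i : 'I_(\dim {: L})) : R := g onb`_i onb`_i.

Definition endo_prod (F G : 'End(L)) : R :=
  \sum_(i < \dim {: L}) onb_sign i * g (F onb`_i) (G onb`_i).

(* The coefficient of e^i /\ e^j (i < j) in a two-form a is a e_i e_j, with    *)
(* (e^i /\ e^j)(X, Y) = e^i(X) e^j(Y) - e^j(X) e^i(Y).                         *)
Definition form2_prod (a b : L -> L -> R) : R :=
  \sum_(i < \dim {: L}) \sum_(j < \dim {: L} | (i < j)%N)
     onb_sign i * onb_sign j * (a onb`_i onb`_j * b onb`_i onb`_j).

End Metric.

Definition lftrace (K : fieldType) (V : vectType K) (f : 'End(V)) : K :=
  \tr (passmx.mxof (vbasis {: V}) (vbasis {: V}) f).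

Section GeneralisedGeometry.
Variables (R : realType) (L : lieAlgType R).

Definition gtangent : vectType R := (L * dual L)%type.
Local Notation E := gtangent.

Definition dorfman (H : closed3form L) (u v : E) : E :=
  (lie u.1 v.1,
   linfun (ce_diff1 v.2 u.1 : L -> R^o) - linfun (ce_diff1 u.2 v.1 : L -> R^o)
   + linfun (H u.1 v.1 : L -> R^o)).

Lemma dorfmanE H u v Z :
  (dorfman H u v).2 Z = - v.2 (lie u.1 Z) + u.2 (lie v.1 Z) + H u.1 v.1 Z.
Proof.
have lin (xi : dual L) X : linear (ce_diff1 xi X : L -> R^o).
  by move=> a U V; rewrite /ce_diff1 linearPr linearP opprD scalerN.
have linH : linear (H u.1 v.1 : L -> R^o) by apply: form3_linear3.
rewrite /= !lfunE /= lfunE /= opp_lfunE !linfun_linearE //.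
by rewrite /ce_diff1 opprK.
Qed.

Lemma dorfman_linearr H u : linear (dorfman H u).
Proof.
move=> a v w; rewrite [LHS]surjective_pairing [RHS]surjective_pairing.
congr (_, _); first by rewrite /= linearPr.
apply/lfunP => Z.
have aux (f h : dual L) Y : (a *: f + h) Y = a * f Y + h Y.
  by rewrite add_lfunE scale_lfunE.
transitivity (a * (dorfman H u v).2 Z + (dorfman H u w).2 Z); last exact/esym/aux.
rewrite !dorfmanE.
have -> : (a *: v + w).2 (lie u.1 Z) = a * v.2 (lie u.1 Z) + w.2 (lie u.1 Z).
  exact: aux.
have -> : (a *: v + w).1 = a *: v.1 + w.1 by [].
have -> : u.2 (lie (a *: v.1 + w.1) Z) = a * u.2 (lie v.1 Z) + u.2 (lie w.1 Z).
  by rewrite linearPl linearP.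
rewrite form3_linear2; ring.
Qed.

Variable g : pseudoMetric L.

Definition gmetric : 'End(E) := linfun (fun u : E => (sharp g u.2, flat g u.1)).

Lemma gmetricE u : gmetric u = (sharp g u.2, flat g u.1).
Proof. by rewrite linfun_linearE // => a [X xi] [Y eta]; rewrite /= !linearP. Qed.

Definition Eplus : {vspace E} := limg (linfun (fun X : L => (X, flat g X) : E)).
Definition Eminus : {vspace E} := limg (linfun (fun X : L => (X, - flat g X) : E)).

Definition proj_plus : 'End(E) := 2^-1 *: (\1 + gmetric)%VF.
Definition proj_minus : 'End(E) := 2^-1 *: (\1 - gmetric)%VF.

Lemma mem_Eplus (u : E) : reflect (exists X, u = (X, flat g X)) (u \in Eplus).
Proof.
have lin : linear (fun X : L => (X, flat g X) : E).
  by move=> a X Y; rewrite linearP.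
apply: (iffP memv_imgP) => [[X _ ->]|[X ->]]; exists X; rewrite ?memvf //.
  by rewrite (linfun_linearE lin).
by rewrite (linfun_linearE lin).
Qed.

Lemma mem_Eminus (u : E) : reflect (exists X, u = (X, - flat g X)) (u \in Eminus).
Proof.
have lin : linear (fun X : L => (X, - flat g X) : E).
  by move=> a X Y; rewrite linearP opprD -scalerN.
apply: (iffP memv_imgP) => [[X _ ->]|[X ->]]; exists X; rewrite ?memvf //.
  by rewrite (linfun_linearE lin).
by rewrite (linfun_linearE lin).
Qed.

Lemma proj_plusE u : proj_plus u = 2^-1 *: (u + gmetric u).
Proof. by rewrite lfunE /= lfunE /= lfunE. Qed.

Lemma proj_minusE u : proj_minus u = 2^-1 *: (u - gmetric u).
Proof. by rewrite lfunE /= lfunE /= lfunE opp_lfunE. Qed.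

Lemma proj_plus_mem u : proj_plus u \in Eplus.
Proof.
apply/mem_Eplus; exists (2^-1 *: (u.1 + sharp g u.2)).
rewrite proj_plusE gmetricE linearZ /= (linearD (flat g)) /= sharpK (addrC (flat g _)).
by case: u.
Qed.

Lemma proj_minus_mem u : proj_minus u \in Eminus.
Proof.
apply/mem_Eminus; exists (2^-1 *: (u.1 - sharp g u.2)).
rewrite proj_minusE gmetricE linearZ /= (linearB (flat g)) /= sharpK -scalerN opprB.
by case: u.
Qed.

Variables (H : closed3form L) (delta : 'Hom(E, R^o)).

(* vsproj only retypes here: proj_plus and proj_minus take values in Eplus and *)
(* Eminus, where vsproj is the identity.                                       *)
Definition Gamma_plus (u : E) : 'Hom(subvs_of Eminus, subvs_of Eplus) :=
  linfun (fun w => vsproj Eplus (proj_plus (dorfman H u (vsval w)))).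
Definition Gamma_minus (v : E) : 'Hom(subvs_of Eplus, subvs_of Eminus) :=
  linfun (fun w => vsproj Eminus (proj_minus (dorfman H v (vsval w)))).

Lemma Gamma_plusE u w :
  vsval (Gamma_plus u w) = proj_plus (dorfman H u (vsval w)).
Proof.
rewrite linfun_linearE ?vsprojK ?proj_plus_mem // => a x y.
by rewrite linearP dorfman_linearr !linearP.
Qed.

Lemma Gamma_minusE v w :
  vsval (Gamma_minus v w) = proj_minus (dorfman H v (vsval w)).
Proof.
rewrite linfun_linearE ?vsprojK ?proj_minus_mem // => a x y.
by rewrite linearP dorfman_linearr !linearP.
Qed.

Definition ricci_plus (v u : E) : R :=
  - lftrace (Gamma_minus v \o Gamma_plus u)%VF + delta (proj_plus (dorfman H v u)).
Definition ricci_minus (u v : E) : R :=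
  - lftrace (Gamma_minus v \o Gamma_plus u)%VF + delta (proj_minus (dorfman H u v)).

Definition generalised_einstein : Prop :=
  (forall u v, u \in Eplus -> v \in Eminus -> ricci_plus v u = 0) /\
  (forall u v, u \in Eplus -> v \in Eminus -> ricci_minus u v = 0).

End GeneralisedGeometry.

(* Main.v *)
(* Write u = X + X^flat and v = Y - Y^flat.  In terms of base points, Gamma_u  *)
(* is S_X + (ad^*(X) + H_X)/2 and Gamma_v is S_Y + (ad^*(Y) - H_Y)/2 with      *)
(* S_X = ad_X^S.  Since S_X is self-adjoint while ad^*(X) and H_X are          *)
(* skew-adjoint, the mixed traces vanish and tr(Gamma_v Gamma_u) splits into a *)
(* symmetric and a skew-symmetric bilinear form in (X, Y).  Half the sum and   *)
(* half the difference of RC^+ = 0 and RC^- = 0 are again bilinear equations;  *)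
(* their symmetric and skew parts are the four equations, the symmetric ones   *)
(* being recovered from their diagonals by polarisation.                       *)
Require Import Defs.
From mathcomp Require Import all_boot all_order all_algebra.
From mathcomp Require Import reals.
From mathcomp Require Import ring lra.

Set Implicit Arguments.
Unset Strict Implicit.
Unset Printing Implicit Defensive.

Import GRing.Theory Num.Theory.
Local Open Scope ring_scope.

(** The trace of Gamma_v Gamma_u is the scalar product of Gamma_u with the adjoint of Gamma_v;
    self-adjoint and skew-adjoint maps being orthogonal, 4 tr = s - k with s = [ricci_sym] symmetric
    and k = [ricci_skew] skew in (X, Y) ([lftrace_GammaE]). Put Q = ad_X^* Y + ad_Y^* X, let a, q, h
    be the values of [delta_tangent] on [X,Y], Q, H_X Y, and a', q', h' those of [delta_flat]. Then
    [ricci_plusE] and [ricci_minusE] read 4 RC^+ = -(s - k) - 2(a + q + h + a' + q' + h'), 4 RC^- =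
    -(s - k) + 2(a - q - h - a' + q' + h'). Both vanish iff s - k = -2(q + h + a') and a + q' + h' =
    0. As s, q, q' are symmetric and the other terms skew, this splits into s = -2q, k = 2(h + a'),
    q' = 0 and a + h' = 0 ([generalised_einsteinE]). Since Q(X,X) = 2 ad_X^* X, the first and third
    restrict to the stated diagonal equations and come back by [polarisation]. *)

(** * Traces and polarisation *)

Lemma lftrace_coord (K : fieldType) (V : vectType K) (f : 'End(V)) :
  lftrace f = \sum_i coord (vbasis {: V}) i (f (vbasis {: V})`_i).
Proof.
apply: eq_bigr => i _.
by rewrite [LHS]mxE /= [LHS]mxE /= passmx.vecof_delta.
Qed.

(** The rank-one map v -> phi(v) w has trace phi(w). This allows a trace to be read off from any
    convenient expansion, with no change of basis from [vbasis]. *)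
Lemma lftrace_rank1_sum (K : fieldType) (V : vectType K) (I : finType)
    (f : 'End(V)) (phi : I -> V -> K) (w : I -> V) :
    (forall i, scalar (phi i)) -> (forall v, f v = \sum_i phi i v *: w i) ->
  lftrace f = \sum_i phi i (w i).
Proof.
move=> phi_lin fE; rewrite lftrace_coord.
under eq_bigr do rewrite fE linear_sum /=.
rewrite exchange_big /=; apply: eq_bigr => i _.
have phiE v : phi i v = linfun (phi i : V -> K^o) v.
  by rewrite linfun_linearE.
rewrite [in RHS](coord_vbasis (memvf (w i))) phiE linear_sum /=.
by apply: eq_bigr => k _; rewrite linearZ linearZ_LR /= -phiE mulrC.
Qed.

Lemma polarisation (R : realType) (V : zmodType) (f : V -> V -> R) :
    (forall X Y, f X Y = f Y X) ->
    (forall X Y Z, f (X + Y) Z = f X Z + f Y Z) -> (forall X, f X X = 0) ->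
  forall X Y, f X Y = 0.
Proof.
move=> fC fD f0 X Y; have := f0 (X + Y).
rewrite fD (fC X) (fC Y) !fD !f0 (fC Y X); lra.
Qed.

Section MetricLie.
Variables (R : realType) (L : lieAlgType R) (g : pseudoMetric L).
Variable H : closed3form L.

(** * Orthonormal expansions and the scalar product of endomorphisms *)

Lemma metric_inj X Y : (forall Z, g X Z = g Y Z) -> X = Y.
Proof.
move=> eqXY; apply/eqP; rewrite -subr_eq0; apply/eqP/(metric_eq0 (g := g)) => Z.
by rewrite linearBl /= eqXY subrr.
Qed.

Lemma onb_sign2 i : onb_sign g i * onb_sign g i = 1.
Proof.
have [[_ e1] _] := onbP g.
by rewrite /onb_sign; case: (e1 i) => ->; rewrite ?mulrNN mulr1.
Qed.

Lemma onb_decomp X : X = \sum_i (onb_sign g i * g X (onb g)`_i) *: (onb g)`_i.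
Proof.
have [[eo _] eb] := onbP g.
rewrite {1}(coord_basis eb (memvf X)); apply: eq_bigr => i _; congr (_ *: _).
rewrite {2}(coord_basis eb (memvf X)) linear_sumlz (bigD1 i) //= big1 => [|j ji].
  by rewrite addr0 linearZl_LR /= mulrCA onb_sign2 mulr1.
by rewrite linearZl_LR /= eo ?mulr0.
Qed.

Lemma metric_onb X Y :
  g X Y = \sum_i onb_sign g i * (g X (onb g)`_i * g Y (onb g)`_i).
Proof.
rewrite {1}(onb_decomp X) linear_sumlz; apply: eq_bigr => i _.
by rewrite linearZl_LR /= (metricC g (onb g)`_i) mulrA.
Qed.

Lemma endo_prodE F G : endo_prod g F G =
  \sum_i \sum_j onb_sign g i * onb_sign g j *
     (g (F (onb g)`_i) (onb g)`_j * g (G (onb g)`_i) (onb g)`_j).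
Proof.
apply: eq_bigr => i _; rewrite metric_onb mulr_sumr.
by apply: eq_bigr => j _; rewrite mulrA.
Qed.

Lemma endo_prodC F G : endo_prod g F G = endo_prod g G F.
Proof. by apply: eq_bigr => i _; rewrite metricC. Qed.

Lemma endo_prodDl F1 F2 G :
  endo_prod g (F1 + F2) G = endo_prod g F1 G + endo_prod g F2 G.
Proof.
rewrite -big_split; apply: eq_bigr => i _.
by rewrite add_lfunE linearDl /= mulrDr.
Qed.

Lemma endo_prodZl a F G : endo_prod g (a *: F) G = a * endo_prod g F G.
Proof.
rewrite mulr_sumr; apply: eq_bigr => i _.
by rewrite scale_lfunE linearZl_LR /= mulrCA.
Qed.

Lemma endo_prodNl F G : endo_prod g (- F) G = - endo_prod g F G.
Proof. by rewrite -scaleN1r endo_prodZl mulN1r. Qed.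

Lemma endo_prodDr F G1 G2 :
  endo_prod g F (G1 + G2) = endo_prod g F G1 + endo_prod g F G2.
Proof. by rewrite endo_prodC endo_prodDl !(endo_prodC F). Qed.

Lemma endo_prodZr a F G : endo_prod g F (a *: G) = a * endo_prod g F G.
Proof. by rewrite endo_prodC endo_prodZl (endo_prodC F). Qed.

Lemma endo_prodNr F G : endo_prod g F (- G) = - endo_prod g F G.
Proof. by rewrite endo_prodC endo_prodNl (endo_prodC F). Qed.

(** In an orthonormal basis F has a symmetric and G a skew matrix of values of g, so exchanging the
    two summation indices negates the sum. *)
Lemma endo_prod_sym_skew (F G : 'End(L)) :
    (forall X Y, g (F X) Y = g X (F Y)) -> (forall X Y, g (G X) Y = - g X (G Y)) ->
  endo_prod g F G = 0.
Proof.
move=> Fsym Gskew.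
suff : endo_prod g F G = - endo_prod g F G by lra.
rewrite {1}endo_prodE exchange_big endo_prodE -sumrN; apply: eq_bigr => i _.
rewrite -sumrN; apply: eq_bigr => j _.
by rewrite Fsym Gskew (metricC g _ (F _)) (metricC g _ (G _)); ring.
Qed.

(** * Adjointness and additivity of ad_X^S, ad^*(X) and H_X *)

Lemma symmetrisation_adjoint (F : 'End(L)) X Y :
  g (symmetrisation g F X) Y = g X (symmetrisation g F Y).
Proof.
rewrite !scale_lfunE !add_lfunE linearZl_LR linearZr_LR linearDl linearDr /=.
by rewrite adjointE (metricC g (adjoint g F X)) adjointE (metricC g X) addrC.
Qed.

Lemma adstar_metric X Y Z : g (adstar g X Y) Z = g X (lie Y Z).
Proof. by rewrite adstarE metricC adjointE adE metricC. Qed.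

Lemma lieC (X Y : L) : lie X Y = - lie Y X.
Proof.
have := liexx (X + Y); rewrite linearDl /= !linearDr /= !liexx addr0 add0r.
by move/eqP; rewrite addr_eq0 => /eqP.
Qed.

Lemma adstar_skew X Y Z : g (adstar g X Y) Z = - g Y (adstar g X Z).
Proof. by rewrite (metricC g Y) !adstar_metric lieC linearNr. Qed.

Lemma form3_add2 X Y1 Y2 Z : H X (Y1 + Y2) Z = H X Y1 Z + H X Y2 Z.
Proof. by have := form3_linear2 H X Z 1 Y1 Y2; rewrite scale1r mul1r. Qed.

Lemma form3_add1 X1 X2 Y Z : H (X1 + X2) Y Z = H X1 Y Z + H X2 Y Z.
Proof. by have := form3_linear1 H Y Z 1 X1 X2; rewrite scale1r mul1r. Qed.

Lemma form3_add3 X Y Z1 Z2 : H X Y (Z1 + Z2) = H X Y Z1 + H X Y Z2.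
Proof. by have := form3_linear3 H X Y 1 Z1 Z2; rewrite scale1r mul1r. Qed.

Lemma form3_skew12 X Y Z : H X Y Z = - H Y X Z.
Proof.
have := form3_alt12 H (X + Y) Z; rewrite form3_add1 !form3_add2 !form3_alt12.
lra.
Qed.

Lemma form3_skew23 X Y Z : H X Y Z = - H X Z Y.
Proof.
have := form3_alt23 H X (Y + Z); rewrite form3_add2 !form3_add3 !form3_alt23.
lra.
Qed.

Lemma form_endo_skew X Y Z : g (form_endo g H X Y) Z = - g Y (form_endo g H X Z).
Proof. by rewrite (metricC g Y) !form_endoE form3_skew23. Qed.

Lemma form_endoC X Y : form_endo g H X Y = - form_endo g H Y X.
Proof.
by apply: metric_inj => Z; rewrite linearNl /= !form_endoE form3_skew12.
Qed.

Lemma flat_form_endo X Y : flat g (form_endo g H X Y) = linfun (H X Y : L -> R^o).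
Proof.
apply/lfunP => Z; rewrite flatE form_endoE linfun_linearE //.
exact: form3_linear3.
Qed.

Lemma adstarD X Y : adstar g (X + Y) = adstar g X + adstar g Y.
Proof.
apply/lfunP => Z; apply: metric_inj => W.
by rewrite add_lfunE linearDl /= !adstar_metric linearDl.
Qed.

Lemma adD (X Y : L) : ad (X + Y) = ad X + ad Y.
Proof. by apply/lfunP => Z; rewrite add_lfunE !adE linearDl. Qed.

Lemma adjointD F G : adjoint g (F + G) = adjoint g F + adjoint g G.
Proof.
apply/lfunP => Z; apply: metric_inj => W.
rewrite add_lfunE linearDl /= !(metricC g _ W) !adjointE.
by rewrite add_lfunE linearDl.
Qed.

Lemma symmetrisationD F G :
  symmetrisation g (F + G) = symmetrisation g F + symmetrisation g G.
Proof. by rewrite /symmetrisation adjointD addrACA scalerDr. Qed.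

Lemma form_endoD X Y : form_endo g H (X + Y) = form_endo g H X + form_endo g H Y.
Proof.
apply/lfunP => Z; apply: metric_inj => W.
by rewrite add_lfunE linearDl /= !form_endoE form3_add1.
Qed.

(** Two-forms are summed over i < j only, endomorphisms over all pairs; the summand is symmetric and
    vanishes for i = j. This accounts for the coefficient 2 of the H-term in the first equation. *)
Lemma form2_prod_form3 X :
  2 * form2_prod g (H X) (H X) = endo_prod g (form_endo g H X) (form_endo g H X).
Proof.
rewrite endo_prodE.
under [RHS]eq_bigr do under eq_bigr do rewrite form_endoE.
pose F i j := onb_sign g i * onb_sign g j *
  (H X (onb g)`_i (onb g)`_j * H X (onb g)`_i (onb g)`_j).
have Fsym i j : F i j = F j i.
  by rewrite /F (form3_skew23 X (onb g)`_i); ring.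
have Fdiag i : F i i = 0 by rewrite /F form3_alt23 !mulr0.
rewrite -[RHS]/(\sum_i \sum_j F i j).
have split_row i : \sum_j F i j =
    \sum_(j < \dim {: L} | (i < j)%N) F i j + \sum_(j < \dim {: L} | (j < i)%N) F i j.
  rewrite (bigID (fun j : 'I__ => (i < j)%N)) /=; congr (_ + _).
  rewrite (bigD1 i) ?ltnn //= Fdiag add0r; apply: eq_bigl => j.
  by rewrite -leqNgt -val_eqE /= ltn_neqAle andbC.
under [RHS]eq_bigr do rewrite split_row.
rewrite big_split /= [X in _ = _ + X](exchange_big_dep predT) //=.
rewrite mulr2n mulrDl !mul1r; congr (_ + _).
by apply: eq_bigr => i _; apply: eq_bigr => j _; rewrite Fsym.
Qed.

(** * Projected Dorfman brackets in terms of base points *)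

Lemma proj_plus_flat (u : gtangent L) :
  proj_plus g u = (2^-1 *: (u.1 + sharp g u.2), flat g (2^-1 *: (u.1 + sharp g u.2))).
Proof.
rewrite proj_plusE gmetricE linearZ /= (linearD (flat g)) /= sharpK (addrC (flat g _)).
by case: u.
Qed.

Lemma proj_minus_flat (u : gtangent L) :
  proj_minus g u =
  (2^-1 *: (u.1 - sharp g u.2), - flat g (2^-1 *: (u.1 - sharp g u.2))).
Proof.
rewrite proj_minusE gmetricE linearZ /= (linearB (flat g)) /= sharpK -scalerN opprB.
by case: u.
Qed.

(** Under [sharp], the covector Z -> eta([X,Z]) becomes ad_X^* applied to [sharp g eta], so the
    bracket is expressed by adjoints on L. *)
Lemma sharp_dorfman X xi Y eta : sharp g (dorfman H (X, xi) (Y, eta)).2 =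
  - adjoint g (ad X) (sharp g eta) + adjoint g (ad Y) (sharp g xi) + form_endo g H X Y.
Proof.
apply: metric_inj => Z; rewrite sharpE dorfmanE /= !linearDl linearNl /= form_endoE.
by rewrite !(metricC g (adjoint _ _ _)) !adjointE !adE !(metricC g (lie _ _)) !sharpE.
Qed.

(** The sum ad_X + ad_X^* is written as twice the symmetrisation, to display one self-adjoint and
    two skew-adjoint summands. *)
Definition Gamma_plus_base X : 'End(L) :=
  2^-1 *: (2 *: symmetrisation g (ad X) + adstar g X + form_endo g H X).

Definition Gamma_minus_base X : 'End(L) :=
  2^-1 *: (2 *: symmetrisation g (ad X) + adstar g X - form_endo g H X).

Lemma proj_plus_dorfman X Z :
  proj_plus g (dorfman H (X, flat g X) (Z, - flat g Z)) =
  (Gamma_plus_base X Z, flat g (Gamma_plus_base X Z)).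
Proof.
rewrite proj_plus_flat sharp_dorfman linearN /= !flatK.
suff -> : lie X Z + (- adjoint g (ad X) (- Z) + adjoint g (ad Z) X + form_endo g H X Z)
    = (2 *: symmetrisation g (ad X) + adstar g X + form_endo g H X) Z.
  by rewrite /Gamma_plus_base scale_lfunE.
rewrite !add_lfunE !scale_lfunE scalerA mulfV ?pnatr_eq0 // scale1r add_lfunE adE adstarE.
by rewrite linearN opprK !addrA.
Qed.

Lemma proj_minus_dorfman X Z :
  proj_minus g (dorfman H (X, - flat g X) (Z, flat g Z)) =
  (Gamma_minus_base X Z, - flat g (Gamma_minus_base X Z)).
Proof.
rewrite proj_minus_flat sharp_dorfman linearN /= !flatK.
suff -> : lie X Z - (- adjoint g (ad X) Z + adjoint g (ad Z) (- X) + form_endo g H X Z)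
    = (2 *: symmetrisation g (ad X) + adstar g X - form_endo g H X) Z.
  by rewrite /Gamma_minus_base scale_lfunE.
rewrite !add_lfunE opp_lfunE !scale_lfunE scalerA mulfV ?pnatr_eq0 // scale1r !add_lfunE adE adstarE.
by rewrite linearN !opprD !opprK !addrA.
Qed.

(** * The trace of Gamma_v Gamma_u *)

Lemma lftrace_Gamma X Y :
  lftrace (Gamma_minus g H (Y, - flat g Y) \o Gamma_plus g H (X, flat g X))%VF =
  \sum_i onb_sign g i *
    g (Gamma_minus_base Y (Gamma_plus_base X (onb g)`_i)) (onb g)`_i.
Proof.
(* Z -> Z - Z^flat identifies L with E_-; the orthonormal basis of L is transported along it. *)
pose lift (Z : L) : subvs_of (Eminus g) := vsproj (Eminus g) (Z, - flat g Z).
have liftE Z : vsval (lift Z) = (Z, - flat g Z).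
  by rewrite vsprojK //; apply/mem_Eminus; exists Z.
have lift_lin : linear lift.
  move=> a U V; rewrite /lift -linearP; congr (vsproj _ (_, _)).
  by rewrite linearP opprD -scalerN.
have lift_fst w : w = lift (vsval w).1.
  by apply: val_inj; rewrite /= liftE; case/mem_Eminus: (valP w) => Z ->.
have compE Z : vsval ((Gamma_minus g H (Y, - flat g Y)
    \o Gamma_plus g H (X, flat g X))%VF (lift Z)) =
    (Gamma_minus_base Y (Gamma_plus_base X Z),
     - flat g (Gamma_minus_base Y (Gamma_plus_base X Z))).
  by rewrite comp_lfunE Gamma_minusE Gamma_plusE liftE proj_plus_dorfman proj_minus_dorfman.
rewrite (lftrace_rank1_sum
  (phi := fun i w => onb_sign g i * g (vsval w).1 (onb g)`_i)
  (w := fun i => (Gamma_minus g H (Y, - flat g Y)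
                   \o Gamma_plus g H (X, flat g X))%VF (lift (onb g)`_i))).
- by apply: eq_bigr => i _; rewrite compE.
- by move=> i a u v; rewrite linearP /= linearPl /= mulrDr mulrCA.
move=> w; rewrite {1}(lift_fst w) (onb_decomp (vsval w).1).
rewrite -(linfun_linearE lift_lin) !linear_sum /=; apply: eq_bigr => i _.
by rewrite !linearZ /= linfun_linearE // -onb_decomp.
Qed.

(** On the diagonal this is the right-hand side of the first equation, by [form2_prod_form3]. *)
Definition ricci_sym X Y : R :=
  4 * endo_prod g (symmetrisation g (ad X)) (symmetrisation g (ad Y))
  - endo_prod g (adstar g X) (adstar g Y)
  + endo_prod g (form_endo g H X) (form_endo g H Y).

Definition ricci_skew X Y : R :=
  endo_prod g (form_endo g H X) (adstar g Y)
  - endo_prod g (form_endo g H Y) (adstar g X).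

Lemma ricci_symC X Y : ricci_sym X Y = ricci_sym Y X.
Proof.
by rewrite /ricci_sym endo_prodC (endo_prodC (adstar g X)) (endo_prodC (form_endo g H X)).
Qed.

Lemma ricci_symD X1 X2 Y : ricci_sym (X1 + X2) Y = ricci_sym X1 Y + ricci_sym X2 Y.
Proof.
rewrite /ricci_sym adD symmetrisationD adstarD form_endoD !endo_prodDl; ring.
Qed.

Lemma ricci_skewC X Y : ricci_skew X Y = - ricci_skew Y X.
Proof. by rewrite /ricci_skew opprB. Qed.

Lemma lftrace_GammaE X Y :
  4 * lftrace (Gamma_minus g H (Y, - flat g Y) \o Gamma_plus g H (X, flat g X))%VF =
  ricci_sym X Y - ricci_skew X Y.
Proof.
rewrite lftrace_Gamma.
pose A := 2 *: symmetrisation g (ad X) + adstar g X + form_endo g H X.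
(* B/2 is the adjoint of [Gamma_minus_base Y]: passing to the adjoint flips the signs of both
   skew-adjoint summands. *)
pose B := 2 *: symmetrisation g (ad Y) - adstar g Y + form_endo g H Y.
have Badj U V : g (Gamma_minus_base Y U) V = 2^-1 * g U (B V).
  rewrite /Gamma_minus_base /B.
  move: (symmetrisation g _) (symmetrisation_adjoint (ad Y)) => S Ssym.
  rewrite !scale_lfunE !add_lfunE !opp_lfunE !linearZl_LR !linearDl !linearDr /=.
  rewrite !linearNl !linearNr /= !scale_lfunE linearZr_LR linearZl_LR /=.
  rewrite Ssym adstar_skew form_endo_skew; ring.
transitivity (endo_prod g A B).
  rewrite mulr_sumr; apply: eq_bigr => i _.
  rewrite Badj /Gamma_plus_base scale_lfunE linearZl_LR /= -/A.
  by move: (g _ _) (onb_sign g i) => x y; field.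
have sym_skew Z (K : 'End(L)) : (forall U V, g (K U) V = - g U (K V)) ->
    endo_prod g (symmetrisation g (ad Z)) K = 0.
  by move=> Kskew; apply: endo_prod_sym_skew => // U V; apply: symmetrisation_adjoint.
have skew_sym Z (K : 'End(L)) : (forall U V, g (K U) V = - g U (K V)) ->
    endo_prod g K (symmetrisation g (ad Z)) = 0.
  by move=> Kskew; rewrite endo_prodC sym_skew.
have := (sym_skew X _ (adstar_skew Y), sym_skew X _ (form_endo_skew Y)).
have := (skew_sym Y _ (adstar_skew X), skew_sym Y _ (form_endo_skew X)).
rewrite /A /B /ricci_sym /ricci_skew (endo_prodC (form_endo g H Y)).
move: (symmetrisation g (ad X)) (symmetrisation g (ad Y)) => SX SY [e1 e2] [e3 e4].
rewrite !(endo_prodDl, endo_prodDr, endo_prodNr, endo_prodZl, endo_prodZr).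
rewrite e1 e2 e3 e4; ring.
Qed.

(** * The divergence terms and the two Ricci curvatures *)

Lemma dualZ (xi : dual L) a X : xi (a *: X) = a * xi X.
Proof. exact: linearZ. Qed.

Lemma dualD (xi : dual L) X Y : xi (X + Y) = xi X + xi Y.
Proof. exact: linearD. Qed.

Lemma dualN (xi : dual L) X : xi (- X) = - xi X.
Proof. exact: linearN. Qed.

Variable delta : 'Hom(gtangent L, R^o).

Definition delta_tangent : 'Hom(L, R^o) := linfun (fun X : L => delta (X, 0)).
Definition delta_flat : 'Hom(L, R^o) := linfun (fun X : L => delta (0, flat g X)).

Lemma delta_pair X Y : delta (X, flat g Y) = delta_tangent X + delta_flat Y.
Proof.
have tangent_lin : linear (fun Z : L => delta (Z, 0) : R^o).
  move=> a U V; rewrite -linearP; congr (delta _).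
  by congr (_, _); rewrite /= scaler0 addr0.
have flat_lin : linear (fun Z : L => delta (0, flat g Z) : R^o).
  move=> a U V; rewrite -linearP; congr (delta _).
  by congr (_, _); rewrite /= ?scaler0 ?addr0 // linearP.
rewrite /delta_tangent /delta_flat !(linfun_linearE tangent_lin, linfun_linearE flat_lin).
rewrite -[RHS](linearD delta); congr (delta _).
by congr (_, _); rewrite /= ?addr0 ?add0r.
Qed.

(** The polar form of the quadratic map X -> 2 ad_X^* X. *)
Definition ad_adjoint_sym X Y : L := adjoint g (ad X) Y + adjoint g (ad Y) X.

Lemma ad_adjoint_symC X Y : ad_adjoint_sym X Y = ad_adjoint_sym Y X.
Proof. exact: addrC. Qed.

Lemma ad_adjoint_symD X1 X2 Y :
  ad_adjoint_sym (X1 + X2) Y = ad_adjoint_sym X1 Y + ad_adjoint_sym X2 Y.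
Proof.
by rewrite /ad_adjoint_sym adD adjointD add_lfunE linearD addrACA.
Qed.

Lemma ricci_plusE X Y :
  4 * ricci_plus g H delta (Y, - flat g Y) (X, flat g X) =
  - (ricci_sym X Y - ricci_skew X Y)
  - 2 * (delta_tangent (lie X Y + ad_adjoint_sym X Y + form_endo g H X Y)
         + delta_flat (lie X Y + ad_adjoint_sym X Y + form_endo g H X Y)).
Proof.
rewrite /ricci_plus mulrDr mulrN lftrace_GammaE; congr (_ + _).
rewrite proj_plus_flat sharp_dorfman (linearN (sharp g)) /= !flatK.
(* RC^+ uses the bracket [v,u], with v first: the Lie and H terms change sign on reordering, while
   the adjoint terms already carry the minus sign. *)
have -> : lie Y X + (- adjoint g (ad Y) X + adjoint g (ad X) (- Y) + form_endo g H Y X)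
    = - (lie X Y + ad_adjoint_sym X Y + form_endo g H X Y).
  rewrite (lieC Y) (form_endoC Y) linearN /= !opprD !addrA; congr (_ + _).
  by rewrite addrAC.
rewrite delta_pair !dualZ -[- (lie X Y + _ + _)]scaleN1r !dualZ.
by field.
Qed.

Lemma ricci_minusE X Y :
  4 * ricci_minus g H delta (X, flat g X) (Y, - flat g Y) =
  - (ricci_sym X Y - ricci_skew X Y)
  + 2 * (delta_tangent (lie X Y - ad_adjoint_sym X Y - form_endo g H X Y)
         - delta_flat (lie X Y - ad_adjoint_sym X Y - form_endo g H X Y)).
Proof.
rewrite /ricci_minus mulrDr mulrN lftrace_GammaE; congr (_ + _).
rewrite proj_minus_flat sharp_dorfman (linearN (sharp g)) /= !flatK -[- flat g _]linearN.
have -> : lie X Y - (- adjoint g (ad X) (- Y) + adjoint g (ad Y) X + form_endo g H X Y)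
    = lie X Y - ad_adjoint_sym X Y - form_endo g H X Y.
  by rewrite linearN opprK opprD addrA.
rewrite delta_pair -[- (2^-1 *: _)]scaleN1r !dualZ.
by field.
Qed.

(** The four equations are the symmetric and skew parts of the sum and of the difference of RC^+ = 0
    and RC^- = 0. *)
Lemma generalised_einsteinE : generalised_einstein g H delta <-> forall X Y,
  [/\ ricci_sym X Y = - 2 * delta_tangent (ad_adjoint_sym X Y),
      ricci_skew X Y = 2 * (delta_tangent (form_endo g H X Y) + delta_flat (lie X Y)),
      delta_flat (ad_adjoint_sym X Y) = 0 &
      delta_tangent (lie X Y) + delta_flat (form_endo g H X Y) = 0].
Proof.
split=> [[rp rm] X Y|eqs].
  have plus Z W : ricci_plus g H delta (W, - flat g W) (Z, flat g Z) = 0.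
    by apply: rp; [apply/mem_Eplus; exists Z | apply/mem_Eminus; exists W].
  have minus Z W : ricci_minus g H delta (Z, flat g Z) (W, - flat g W) = 0.
    by apply: rm; [apply/mem_Eplus; exists Z | apply/mem_Eminus; exists W].
  (* Both orders of (X, Y) are needed to separate symmetric from skew parts; after rewriting with
     the symmetries, four linear equations in eight real numbers remain. *)
  have := ricci_plusE X Y; have := ricci_plusE Y X.
  have := ricci_minusE X Y; have := ricci_minusE Y X.
  rewrite !plus !minus (ricci_symC Y X) (ricci_skewC Y X) (ad_adjoint_symC Y X).
  rewrite (lieC Y X) (form_endoC Y X).
  move: (ad_adjoint_sym X Y) => Q; rewrite !(dualD, dualN).
  move: (ricci_sym _ _) (ricci_skew _ _) (delta_tangent _) (delta_tangent _)
    (delta_tangent _) (delta_flat _) (delta_flat _) (delta_flat _) => s k a q h a' q' h'.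
  by move=> e1 e2 e3 e4; split; lra.
split=> u v /mem_Eplus[X ->] /mem_Eminus[Y ->].
  have := ricci_plusE X Y; have [-> -> + +] := eqs X Y.
  move: (ad_adjoint_sym X Y) => Q; rewrite !(dualD, dualN).
  move: (ricci_plus _ _ _ _ _) (delta_tangent _) (delta_tangent _)
    (delta_tangent _) (delta_flat _) (delta_flat _) => r a q h a' h'; lra.
have := ricci_minusE X Y; have [-> -> + +] := eqs X Y.
move: (ad_adjoint_sym X Y) => Q; rewrite !(dualD, dualN).
move: (ricci_minus _ _ _ _ _) (delta_tangent _) (delta_tangent _)
  (delta_tangent _) (delta_flat _) (delta_flat _) => r a q h a' h'; lra.
Qed.

End MetricLie.

Theorem proposition2p18 (R : realType) (L : lieAlgType R)
    (H : closed3form L) (g : pseudoMetric L) (delta : 'Hom(gtangent L, R^o)) :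
  generalised_einstein g H delta <->
  forall X Y : L,
    [/\ - 4 * delta (adjoint g (ad X) X, 0) =
          4 * endo_prod g (symmetrisation g (ad X)) (symmetrisation g (ad X))
          - endo_prod g (adstar g X) (adstar g X)
          + 2 * form2_prod g (H X) (H X),
        2 * delta (sharp g (linfun (H X Y : L -> R^o)), flat g (lie X Y)) =
          endo_prod g (form_endo g H X) (adstar g Y)
          - endo_prod g (form_endo g H Y) (adstar g X),
        delta (0, flat g (adjoint g (ad X) X)) = 0 &
        delta (lie X Y, linfun (H X Y : L -> R^o)) = 0].
Proof.
pose Q := ad_adjoint_sym g.
pose dt := delta_tangent delta; pose df := delta_flat g delta.
have QE X : Q X X = 2 *: adjoint g (ad X) X by rewrite scaler_nat mulr2n.
have dtE Z : delta (Z, 0) = dt Z.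
  by rewrite -(linear0 (flat g)) delta_pair linear0 addr0.
have dfE Z : delta (0, flat g Z) = df Z by rewrite delta_pair linear0 add0r.
apply: (iff_trans (generalised_einsteinE _ _ _)).
split=> eqs X Y; last first.
  (* The first and third equations are known only for X = Y; the functions to be polarised are the
     differences of the two sides of their bilinear versions. *)
  have flat_polar := polarisation (f := fun X Y => df (Q X Y)).
  have sym_polar := polarisation (f := fun X Y => ricci_sym g H X Y + 2 * dt (Q X Y)).
  have [_ e2 _ e4] := eqs X Y; split.
  - have := sym_polar _ _ _ X Y; rewrite -/dt -/Q mulNr => sym0.
    apply/eqP; rewrite -addr_eq0; apply/eqP/sym0 => [U V|U V W|Z].
    + by rewrite ricci_symC /Q ad_adjoint_symC.
    + by rewrite ricci_symD /Q ad_adjoint_symD linearD mulrDr addrACA.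
    have [+ _ _ _] := eqs Z Z; rewrite dtE form2_prod_form3 -/(ricci_sym _ _ _ _).
    by rewrite QE dualZ => <-; ring.
  - by move: e2; rewrite -(flat_form_endo g) flatK delta_pair => ->.
  - apply: flat_polar => [U V|U V W|Z].
    + by rewrite /Q ad_adjoint_symC.
    + by rewrite /Q ad_adjoint_symD linearD.
    by have [_ _ + _] := eqs Z Z; rewrite dfE QE dualZ => ->; rewrite mulr0.
  - by move: e4; rewrite -(flat_form_endo g) delta_pair.
(* Conversely the quadratic equations are the case Y = X, where [Q X X] supplies the factor 2 that
   turns -2 into -4. *)
have [e1 _ e3 _] := eqs X X; have [_ e2 _ e4] := eqs X Y; split.
- rewrite dtE form2_prod_form3 -/(ricci_sym _ _ _ _) e1 -/dt -/(Q X X) QE dualZ; ring.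
- by rewrite -(flat_form_endo g) flatK delta_pair -e2.
- by move: e3; rewrite dfE -/df -/(Q X X) QE dualZ; lra.
- by rewrite -(flat_form_endo g) delta_pair.
Qed.
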